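(* Let $F\in C^{2,\beta}_{loc}(\mathbb{R})$ for some $\beta>0$ with $F\ge 0$. Let $u$ be a bounded solution to $$\Delta u=u_t+F'(u)\qquad\text{in }\mathbb{R}^n\times(-\infty,0].$$ Then $$|Du(x,t)|^2-2F(u(x,t))\le 0\qquad\text{for all }(x,t)\in\mathbb{R}^n\times(-\infty,0].$$
   Context: $D$ and $\Delta$ denote the gradient and Laplacian with respect to the space variable $x\in\mathbb{R}^n$ only; $u_t$ is the time derivative. Solutions are understood in the classical sense (continuous derivatives up to order two in $x$ and order one in $t$, with the equation holding pointwise). *)

(* Defs.v *)
From HB Require Import structures.
From mathcomp Require Import all_boot all_order all_algebra.
From mathcomp Require Import all_classical all_reals all_analysis.

Set Implicit Arguments.
Unset Strict Implicit.
Unset Printing Implicit Defensive.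

Import Order.TTheory GRing.Theory Num.Theory.
Import numFieldNormedType.Exports.

Local Open Scope ring_scope.
Local Open Scope classical_set_scope.

(* C^{2,beta}_loc(R): the Hoelder constant of F'' may depend on the compact
   set. *)
Definition C2_holder_loc (R : realType) (beta : R) (F : R -> R) : Prop :=
  [/\ forall s, derivable F s 1,
      forall s, derivable (derive1 F) s 1,
      continuous (derive1n 2 F) &
      forall K : set R, compact K ->
        exists C : R, forall a b, K a -> K b ->
          `|derive1n 2 F a - derive1n 2 F b| <= C * `|a - b| `^ beta].

(* The norm of the library on 'rV[R]_n is the sup norm, so the Euclidean one is
   written out. *)
Definition enorm (R : realType) (n : nat) (v : 'rV[R]_n) : R :=
  Num.sqrt (\sum_(i < n) v ord0 i ^+ 2).

Section space_time.
Variables (R : realType) (n : nat).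

(* A function on R^n x (-oo, 0] is represented by a total function
   u : 'rV[R]_n -> R -> R; its values at times t > 0 are irrelevant. *)
Definition past : set ('rV[R]_n * R) := [set p | p.2 <= 0].

Implicit Types (u : 'rV[R]_n -> R -> R) (x : 'rV[R]_n) (t : R).

Definition dx u (i : 'I_n) x t : R := 'D_(delta_mx ord0 i) (u ^~ t) x.

Definition gradx u x t : 'rV[R]_n := \row_(i < n) dx u i x t.

Definition laplacex u x t : R := \sum_(i < n) dx (dx u i) i x t.

Definition derivablex u (i : 'I_n) x t : Prop :=
  derivable (u ^~ t) x (delta_mx ord0 i).

(* Time derivative of a function defined for t <= 0 only: two-sided when
   t < 0, one-sided (from the left) at t = 0. *)
Definition dt_filter u x t : set_system R :=
  (fun s => (u x s - u x t) / (s - t)) @ within [set s | s <= 0] t^'.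

Definition derivablet u x t : Prop := cvg (dt_filter u x t).

Definition dt u x t : R := lim (dt_filter u x t).

Definition C21 u : Prop :=
  [/\ forall x t, t <= 0 ->
        [/\ forall i, derivablex u i x t,
            forall i j, derivablex (dx u i) j x t &
            derivablet u x t],
      {within past, continuous (fun p => u p.1 p.2)},
      forall i, {within past, continuous (fun p => dx u i p.1 p.2)},
      forall i j, {within past, continuous (fun p => dx (dx u i) j p.1 p.2)} &
      {within past, continuous (fun p => dt u p.1 p.2)}].

Definition classical_solution (F : R -> R) u : Prop :=
  C21 u /\
  forall x t, t <= 0 -> laplacex u x t = dt u x t + derive1 F (u x t).

End space_time.

Arguments past : clear implicits.

(* Main.v *)
Require Import Defs.
From mathcomp Require Import all_boot all_order all_algebra.
From mathcomp Require Import all_classical all_reals all_analysis.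
From mathcomp Require Import ring lra.
Import Order.TTheory GRing.Theory Num.Theory.
Import numFieldNormedType.Exports.
Local Open Scope ring_scope.
Local Open Scope classical_set_scope.

(** The estimate follows from the maximum principle applied to a function of two
    points. Unlike the equation satisfied by [|Du|^2 - 2 F (u)], which contains
    third derivatives of [u], this uses the equation for [u] itself at the two
    points, so that the derivatives of a classical solution suffice.

    Suppose first [F > 0] and change the unknown to [w = psi (u)] with
    [psi' = 1 / sqrt (2 F)]. The claim becomes [|Dw| <= 1], that is,
    [w (x, t) - w (y, t) <= |x - y|], and the equation becomes
    [Delta w - w_t = a (w) - b (w) |Dw|^2] with [a = b]: the right-hand side
    vanishes where [|Dw| = 1]. At a positive maximum of
    [w (x, t) - w (y, t) - |x - y|] both gradients are equal to the unit vector
    along [x - y], and moving [x] and [y] in parallel gives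
    [Delta w (x) <= Delta w (y)]; the comparison of the two equations then
    yields only the borderline case [0 <= 0]. It becomes a contradiction once
    [a - b] is strictly increasing, since [w (x) > w (y)] at such a point. This is achieved
    by replacing [F] in the definition of [psi] by
    [F + eps (2 - exp (K (s - c)))] with [K] large (lemma [excess_increasing]);
    the same perturbation makes the potential positive.

    The supremum over the unbounded set of points and times is attained after
    subtraction of [tau (|t| + penalty x)], with [penalty] of linear growth and
    with bounded derivatives. This changes the comparison by [O(tau)], which the
    strict monotonicity absorbs ([two_point_max], [ancient_1lipschitz]). The term
    [tau |t|] plays the role of an initial condition: it is available for every
    [tau > 0] because the solution is bounded on the whole past.

    Finally the Lipschitz bound implies the gradient bound
    ([lipschitz_gradient_le1]), and [eps] tends to zero. *)

Set Implicit Arguments.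
Unset Strict Implicit.
Unset Printing Implicit Defensive.

(** * Calculus on the line *)

Lemma ex_antiderivative (R : realType) (q : R -> R) (a b : R) :
  {in `[a, b]%R, continuous q} ->
  exists psi : R -> R, forall s, s \in `]a, b[%R -> is_derive s 1 psi (q s).
Proof.
move=> cq.
exists (fun x => (\int[lebesgue_measure]_(t in `[a, x]) q t)%R) => s.
rewrite in_itv /= => /andP[sa sb].
have int_q : lebesgue_measure.-integrable `[a, b] (EFin \o q).
  apply: continuous_compact_integrable; first exact: segment_compact.
  apply: continuous_in_subspaceT => x; rewrite inE; exact: cq.
have cqs : {for s, continuous q} by apply: cq; rewrite in_itv /= !ltW.
have [dpsi <-] := continuous_FTC1_closed sb int_q sa cqs.
by rewrite derive1E; exact: derivableP.
Qed.

Section quadratic_touching.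
Variables (R : realType) (g dg : R -> R) (a b : R).
Hypothesis g_dg : forall s : R, is_derive s 1 g (dg s).
Hypothesis g_le : forall s, g s <= g 0 + a * s + b * s ^+ 2.

Let h (s : R) : R := g s - a * s - b * s ^+ 2.

Let h_dh (s : R) : is_derive s 1 h (dg s - a - 2 * b * s).
Proof.
have := g_dg s; rewrite /h => ?.
apply: is_derive_eq.
by rewrite /GRing.scale /=; ring.
Qed.

Let h_le s : h s <= h 0.
Proof. by have := g_le s; rewrite /h; lra. Qed.

(** A function touched from above by a quadratic polynomial at the origin
    inherits the first-order coefficient and a bound on its second derivative.
    Maximality in space is always exploited in this form, so that the norm and
    the penalisation are never differentiated. *)
Lemma touching_derive1 : dg 0 = a.
Proof.
have h0 : is_derive (0 : R) 1 h 0.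
  apply: (@derive1_at_max R h (-1) 1) => [|t _||t _]; last exact: h_le.
  - lra.
  - by case: (h_dh t).
  - by rewrite in_itv /= ltrN10 ltr01.
have [_ h0E] := h0; have [_] := h_dh 0.
by rewrite h0E mulr0 subr0 => /eqP; rewrite eq_sym subr_eq0 => /eqP.
Qed.

Lemma touching_derive2 (d2 : R) : is_derive (0 : R) 1 dg d2 -> d2 <= 2 * b.
Proof.
move=> /is_derive1_caratheodory[k [kE ck k0]].
rewrite leNgt; apply/negP => d2b.
(* If d2 exceeded 2 b, the derivative of h would be positive just to the right
   of its maximum point. *)
have : \forall s \near (0 : R), 2 * b < k s.
  by apply: (cvgr_gt (k 0) ck); rewrite k0.
move=> /nbhs_ballP[e /= e0 ke].
have e20 : 0 < e / 2 by rewrite divr_gt0.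
have ch : {within `[0, e / 2], continuous h}.
  apply: continuous_subspaceT => s.
  by apply: differentiable_continuous; apply/derivable1_diffP; case: (h_dh s).
have [c] := MVT e20 (fun s _ => h_dh s) ch.
rewrite in_itv /= => /andP[c0 ce] hE.
have kc : 2 * b < k c.
  by apply: ke; rewrite /ball /= sub0r normrN gtr0_norm//; lra.
have dgc : dg c = a + k c * c.
  by have := kE c; rewrite touching_derive1 subr0; lra.
have : 0 < h (e / 2) - h 0.
  rewrite hE dgc subr0.
  have -> : a + k c * c - a - 2 * b * c = (k c - 2 * b) * c by ring.
  by rewrite !mulr_gt0// subr_gt0.
by rewrite subr_gt0 ltNge h_le.
Qed.

End quadratic_touching.

Lemma is_derive_line (R : realType) (V : normedModType R) (f : V -> R)
    (x v : V) (s : R) :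
  derivable f (x + s *: v) v ->
  is_derive s 1 (fun s => f (x + s *: v)) ('D_v f (x + s *: v)).
Proof.
have quotE : (fun h : R => h^-1 *: (f (x + (h *: 1 + s) *: v) - f (x + s *: v)))
    = (fun h : R => h^-1 *: (f (h *: v + (x + s *: v)) - f (x + s *: v))).
  apply/funext => h; congr (_ *: (f _ - _)).
  by rewrite [h *: 1]mulr1 scalerDl addrCA.
move=> fv; apply: DeriveDef.
  by rewrite /derivable /= quotE.
by rewrite /derive /= quotE.
Qed.

(** * Touching from above by quadratic polynomials *)

(** The square root lies below its tangents; this provides quadratic functions
    touching the norm and the penalisation from above. *)
Lemma sqrt_le_tangent (R : realType) (r s : R) :
  0 < r -> 0 <= s -> Num.sqrt s <= r + (s - r ^+ 2) / (2 * r).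
Proof.
move=> r0 s0; have vs := sqr_sqrtr s0.
have := sqr_ge0 (Num.sqrt s - r); set v := Num.sqrt s in vs * => vr.
by rewrite -lerBlDl ler_pdivlMr ?mulr_gt0// -vs; nra.
Qed.

Section euclidean_norm.
Variables (R : realType) (n : nat).
Implicit Types (x y z : 'rV[R]_n).

Lemma enorm_ge0 z : 0 <= enorm z.
Proof. exact: sqrtr_ge0. Qed.

Lemma enorm_sqr z : enorm z ^+ 2 = \sum_(i < n) z ord0 i ^+ 2.
Proof. by rewrite sqr_sqrtr// sumr_ge0// => i _; rewrite sqr_ge0. Qed.

Lemma enorm0 : enorm (0 : 'rV[R]_n) = 0.
Proof.
by rewrite /enorm big1 ?sqrtr0// => i _; rewrite mxE expr0n.
Qed.

Lemma enormZ (c : R) z : enorm (c *: z) = `|c| * enorm z.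
Proof.
rewrite /enorm -sqrtr_sqr -sqrtrM ?sqr_ge0// mulr_sumr; congr Num.sqrt.
by apply: eq_bigr => i _; rewrite mxE exprMn.
Qed.

Lemma coord_le_enorm z i : `|z ord0 i| <= enorm z.
Proof.
rewrite -sqrtr_sqr ler_wsqrtr// (bigD1 i)//= lerDl sumr_ge0// => j _.
by rewrite sqr_ge0.
Qed.

Lemma sum_line_coord (q : R -> R) z i (s : R) :
  \sum_(j < n) q ((z + s *: delta_mx ord0 i) ord0 j) =
  \sum_(j < n) q (z ord0 j) + (q (z ord0 i + s) - q (z ord0 i)).
Proof.
rewrite (bigD1 i)//= [in RHS](bigD1 i)//= !mxE !eqxx mulr1.
rewrite (eq_bigr (fun j => q (z ord0 j))) => [|j ji]; first by ring.
by rewrite !mxE (negbTE ji) andbF mulr0 addr0.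
Qed.

(** Expanding the square shows that the right-hand side is the tangent at
    [enorm z] of the square root, evaluated at the squared norm on the left. *)
Lemma enorm_line_le z i (s : R) : 0 < enorm z ->
  enorm (z + s *: delta_mx ord0 i) <=
  enorm z + z ord0 i / enorm z * s + (2 * enorm z)^-1 * s ^+ 2.
Proof.
move=> z0; set z' := (z + _).
have z'2 : enorm z' ^+ 2 = enorm z ^+ 2 + 2 * s * z ord0 i + s ^+ 2.
  rewrite !enorm_sqr (sum_line_coord (fun a => a ^+ 2)).
  by ring.
have := sqrt_le_tangent z0 (sqr_ge0 (enorm z')).
rewrite sqrtr_sqr ger0_norm ?enorm_ge0// => /le_trans; apply.
rewrite z'2 le_eqVlt; apply/orP; left; apply/eqP; field.
by rewrite gt_eqF.
Qed.

Lemma continuous_sum_coord (q : R -> R) : continuous q ->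
  continuous (fun x : 'rV[R]_n => \sum_(i < n) q (x ord0 i)).
Proof.
move=> cq; apply: continuous_big => [|i _ x]; first exact: add_continuous.
by apply: (@continuous_comp _ _ _ _ q); [exact: coord_continuous | exact: cq].
Qed.

Lemma continuous_enorm : continuous (@enorm R n).
Proof.
move=> x; apply: (@continuous_comp _ _ _ _ Num.sqrt);
  last exact: sqrt_continuous.
apply: (continuous_sum_coord (q := fun a => a ^+ 2)).
exact: exprn_continuous.
Qed.

Lemma compact_box (M : R) :
  compact [set x : 'rV[R]_n | forall i, x ord0 i \in `[- M, M]%R].
Proof.
by apply: (@rV_compact _ _ (fun=> `[- M, M])) => i; exact: segment_compact.
Qed.

(** This penalisation tends to infinity, which makes maximum points exist on
    unbounded domains, while its first and second derivatives along the
    coordinates stay bounded by one, so that a small multiple of it disturbs an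
    equation only slightly. *)
Definition penalty x : R := \sum_(i < n) Num.sqrt (1 + x ord0 i ^+ 2).

Lemma coord_le_penalty x i : `|x ord0 i| <= penalty x.
Proof.
rewrite /penalty (bigD1 i)//= -sqrtr_sqr.
apply: ler_wpDr; first by rewrite sumr_ge0// => j _; rewrite sqrtr_ge0.
by rewrite ler_wsqrtr// lerDr.
Qed.

Lemma penalty_ge0 x : 0 <= penalty x.
Proof. by rewrite sumr_ge0// => j _; rewrite sqrtr_ge0. Qed.

Definition dpenalty x i : R := x ord0 i / Num.sqrt (1 + x ord0 i ^+ 2).

Lemma sqrt1D_ge1 (s : R) : 1 <= Num.sqrt (1 + s ^+ 2).
Proof. by rewrite -[leLHS]sqrtr1 ler_wsqrtr// lerDl sqr_ge0. Qed.

Lemma dpenalty_le1 x i : `|dpenalty x i| <= 1.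
Proof.
have q1 := sqrt1D_ge1 (x ord0 i).
rewrite /dpenalty normrM normfV (ger0_norm (sqrtr_ge0 _)).
rewrite ler_pdivrMr ?mul1r; last exact: lt_le_trans q1.
by rewrite -sqrtr_sqr ler_wsqrtr// lerDr.
Qed.

(** The second-order coefficient does not depend on the point because the
    tangent of the square root is taken at a value at least one. *)
Lemma penalty_line_le x i (s : R) :
  penalty (x + s *: delta_mx ord0 i) <=
  penalty x + dpenalty x i * s + 2^-1 * s ^+ 2.
Proof.
rewrite /penalty (sum_line_coord (fun a => Num.sqrt (1 + a ^+ 2))).
rewrite -!addrA lerD2l lerBlDl /dpenalty.
set a := x ord0 i; have q1 := sqrt1D_ge1 a.
have q0 : 0 < Num.sqrt (1 + a ^+ 2) by exact: lt_le_trans q1.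
have as0 : 0 <= 1 + (a + s) ^+ 2 by rewrite addr_ge0// sqr_ge0.
apply: le_trans (sqrt_le_tangent q0 as0) _.
rewrite sqr_sqrtr; last by rewrite addr_ge0// sqr_ge0.
rewrite lerD2l; set r := Num.sqrt _ in q1 q0 *.
have -> : (1 + (a + s) ^+ 2 - (1 + a ^+ 2)) / (2 * r)
    = a / r * s + 2^-1 * (r^-1 * s ^+ 2).
  by field; rewrite gt_eqF.
rewrite lerD2l ler_pM2l ?invr_gt0// ler_piMl ?sqr_ge0// invf_le1//.
Qed.

Lemma continuous_penalty : continuous penalty.
Proof.
apply: (continuous_sum_coord (q := fun a => Num.sqrt (1 + a ^+ 2))) => a.
apply: (@continuous_comp _ _ _ (fun a : R => 1 + a ^+ 2) Num.sqrt);
  last exact: sqrt_continuous.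
by apply: cvgD; [exact: cvg_cst | exact: exprn_continuous].
Qed.

End euclidean_norm.

(** * The two-point maximum principle *)

(** Freezing a function at time zero turns continuity relative to the past into
    continuity on the whole space, which composes without side conditions. *)
Lemma past_continuous_min (R : realType) (n : nat) (w : 'rV[R]_n -> R -> R) :
  {within past R n, continuous (fun p => w p.1 p.2)} ->
  continuous (fun p : 'rV[R]_n * R => w p.1 (Num.min p.2 0)).
Proof.
move=> /subspace_continuousP cw p.
pose phi (p : 'rV[R]_n * R) := (p.1, Num.min p.2 0).
have past_phi q : past R n (phi q) by rewrite /past /= ge_min lexx orbT.
have cphi : phi q @[q --> p] --> phi p.
  apply: (@cvg_pair _ _ _ _ (nbhs p.1) (nbhs (Num.min p.2 0)));
    first exact: cvg_fst.
  apply: (@continuous2_cvg _ _ _ _ _ _ _ _ (fun a b => Num.min a b));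
    [exact: (@min_continuous _ R (p.2, 0)) | exact: cvg_snd | exact: cvg_cst].
apply: (@cvg_comp _ _ _ phi (fun q => w q.1 q.2) _
  (within (past R n) (nbhs (phi p)))); last exact: cw.
by move=> U /cphi; apply: (@filterS _ (nbhs p)) => q /= /(_ (past_phi q)).
Qed.

Lemma past_continuous_slice (R : realType) (n : nat) (v : 'rV[R]_n -> R -> R)
    (t : R) : t <= 0 ->
  {within past R n, continuous (fun p => v p.1 p.2)} -> continuous (v ^~ t).
Proof.
move=> t0 cv; have -> : v ^~ t = (fun x => v x (Num.min t 0)) by rewrite min_l.
move=> x; apply: (@continuous_comp _ _ _ (fun x : 'rV[R]_n => (x, t))
  (fun p : 'rV[R]_n * R => v p.1 (Num.min p.2 0))).
  apply: (@cvg_pair _ _ _ (nbhs x) (nbhs x) (nbhs t)); first exact: cvg_id.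
  exact: cvg_cst.
exact: past_continuous_min.
Qed.

Section two_point.
Variables (R : realType) (n : nat) (w : 'rV[R]_n -> R -> R) (A : R).
Hypothesis w_cont : {within past R n, continuous (fun p => w p.1 p.2)}.
Hypothesis w_osc : forall x y t, t <= 0 -> w x t - w y t <= A.

(** The bound [w x t - w y t <= enorm (x - y)] amounts to the nonpositivity of
    this function for small positive [s] and [tau]. The terms in [tau] force a
    positive supremum to be attained: time is bounded below, [x] is bounded,
    and the oscillation bound on [w] then bounds [y]. *)
Definition two_point (s tau : R) (x y : 'rV[R]_n) (t : R) : R :=
  w x t - w y t - enorm (x - y) - s + tau * t - tau * penalty x.

Lemma two_point_max (s tau : R) x1 y1 t1 : 0 <= s -> 0 < tau -> t1 <= 0 ->
  0 < two_point s tau x1 y1 t1 ->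
  exists x0 y0 t0, [/\ t0 <= 0, 0 < two_point s tau x0 y0 t0 &
    forall x y t, t <= 0 -> two_point s tau x y t <= two_point s tau x0 y0 t0].
Proof.
move=> s0 tau0 t10 Z1.
pose Z (p : 'rV[R]_n * 'rV[R]_n * R) :=
  two_point s tau p.1.1 p.1.2 (Num.min p.2 0).
have cZ : continuous Z.
  move=> p; rewrite /Z /two_point.
  have cw (f : 'rV[R]_n * 'rV[R]_n * R -> 'rV[R]_n) : continuous f ->
      {for p, continuous (fun q => w (f q) (Num.min q.2 0))}.
    move=> cf; apply: (@continuous_comp _ _ _ (fun q => (f q, q.2))
      (fun q : 'rV[R]_n * R => w q.1 (Num.min q.2 0))).
      apply: (@cvg_pair _ _ _ _ (nbhs (f p)) (nbhs p.2)); first exact: cf.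
      exact: cvg_snd.
    exact: past_continuous_min.
  have c1 : continuous (fun q : 'rV[R]_n * 'rV[R]_n * R => q.1.1).
    by move=> q; apply: (@continuous_comp _ _ _ fst fst); exact: cvg_fst.
  have c2 : continuous (fun q : 'rV[R]_n * 'rV[R]_n * R => q.1.2).
    move=> q; apply: (@continuous_comp _ _ _ fst snd); first exact: cvg_fst.
    exact: cvg_snd.
  have ct : {for p, continuous
      (fun q : 'rV[R]_n * 'rV[R]_n * R => Num.min q.2 0)}.
    apply: (@continuous2_cvg _ _ _ _ _ _ _ _ (fun a b => Num.min a b));
      [exact: (@min_continuous _ R (p.2, 0)) | exact: cvg_snd | exact: cvg_cst].
  apply: cvgB; last first.
    apply: cvgM; first exact: cvg_cst.
    apply: (@continuous_comp _ _ _
      (fun q : 'rV[R]_n * 'rV[R]_n * R => q.1.1) (@penalty R n)).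
      exact: c1.
    exact: continuous_penalty.
  apply: cvgD; last by apply: cvgM; [exact: cvg_cst | exact: ct].
  apply: cvgB; last exact: cvg_cst.
  apply: cvgB; first by apply: cvgB; apply: cw.
  apply: (@continuous_comp _ _ _
    (fun q : 'rV[R]_n * 'rV[R]_n * R => q.1.1 - q.1.2) (@enorm R n)).
    by apply: cvgB; [exact: c1 | exact: c2].
  exact: continuous_enorm.
have Zle x y t : t <= 0 -> Z (x, y, t) = two_point s tau x y t.
  by move=> t0; rewrite /Z/= min_l.
pose M := A / tau.
pose box (r : R) : set 'rV[R]_n := [set x | forall i, x ord0 i \in `[- r, r]%R].
pose K := (box M `*` box (M + A) `*` `[- M, 0])%classic.
have K_pos x y t : t <= 0 -> 0 < two_point s tau x y t -> K (x, y, t).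
  move=> t0; rewrite /two_point => Z0; have := w_osc x y t0.
  have /= pen0 := penalty_ge0 x; have xy0 := enorm_ge0 (x - y) => wA.
  have tt0 : 0 <= tau * - t by rewrite mulr_ge0// ?oppr_ge0// ltW.
  have tp0 : 0 <= tau * penalty x by rewrite mulr_ge0// ltW.
  have penM : penalty x <= M by rewrite ler_pdivlMr//; lra.
  have tM : - t <= M by rewrite ler_pdivlMr//; lra.
  have xyA : enorm (x - y) <= A by lra.
  have xi i : `|x ord0 i| <= M := le_trans (coord_le_penalty x i) penM.
  split => /=; last by rewrite in_itv/= t0 andbT lerNl.
  split => /= i; rewrite in_itv/= -ler_norml; first exact: xi.
  have -> : y ord0 i = x ord0 i - (x - y) ord0 i by rewrite !mxE; ring.
  apply: le_trans (ler_normB _ _) _; apply: lerD; first exact: xi.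
  exact: le_trans (coord_le_enorm _ _) xyA.
have K1 := K_pos x1 y1 t1 t10 Z1.
have cK : compact K.
  apply: compact_setX; last exact: segment_compact.
  by apply: compact_setX; exact: compact_box.
have K_neq0 : K !=set0 by exists (x1, y1, t1).
have [[[x0 y0] t0]] := compact_EVT_max K_neq0 cK (continuous_subspaceT cZ).
rewrite inE => K0 Zmax.
have t00 : t0 <= 0 by have [_ /=] := K0; rewrite in_itv/= => /andP[].
have Z0 : two_point s tau x1 y1 t1 <= two_point s tau x0 y0 t0.
  by rewrite -!Zle//; apply: Zmax; rewrite inE.
exists x0, y0, t0; split => //; first exact: lt_le_trans Z0.
move=> x y t tle0; have [Zneg|Zpos] := leP (two_point s tau x y t) 0.
  by apply: le_trans Zneg _; apply: ltW; exact: lt_le_trans Z0.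
by rewrite -!Zle//; apply: Zmax; rewrite inE; exact: K_pos.
Qed.

End two_point.

Section comparison.
Variables (R : realType) (n : nat) (w : 'rV[R]_n -> R -> R).
Variables (w1 w2 : 'I_n -> 'rV[R]_n -> R -> R) (wt : 'rV[R]_n -> R -> R).
Variables (a b : 'rV[R]_n -> R -> R) (A Q : R).

Hypothesis w_cont : {within past R n, continuous (fun p => w p.1 p.2)}.
Hypothesis w_osc : forall x y t, t <= 0 -> w x t - w y t <= A.
Hypothesis w_dx : forall i x t (s : R), t <= 0 ->
  is_derive s 1 (fun s => w (x + s *: delta_mx ord0 i) t)
    (w1 i (x + s *: delta_mx ord0 i) t).
Hypothesis w_dxx : forall i x t, t <= 0 ->
  is_derive (0 : R) 1 (fun s => w1 i (x + s *: delta_mx ord0 i) t) (w2 i x t).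
Hypothesis w_dt : forall x t, t <= 0 ->
  (w x s - w x t) / (s - t) @[s --> t^'-] --> wt x t.
(* For w = psi (u) the equation is quasilinear, with a right-hand side that is
   affine in the squared length of the gradient; a - b is its value where the
   gradient has length one. *)
Hypothesis w_eq : forall x t, t <= 0 ->
  \sum_(i < n) w2 i x t - wt x t = a x t - b x t * \sum_(i < n) w1 i x t ^+ 2.
Hypothesis b_bounded : forall x t, t <= 0 -> `|b x t| <= Q.
(* A quantitative form of strict monotonicity of a - b as a function of w. *)
Hypothesis reaction_increasing : forall s, 0 < s ->
  exists2 c : R, 0 < c & forall x y t, t <= 0 -> s <= w x t - w y t ->
    c <= (a x t - b x t) - (a y t - b y t).

Section at_maximum.
Variables (s tau : R) (x0 y0 : 'rV[R]_n) (t0 : R).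
Hypotheses (s_ge0 : 0 <= s) (tau_gt0 : 0 < tau) (tau_le1 : tau <= 1).
Hypotheses (t0_le0 : t0 <= 0) (Z_gt0 : 0 < two_point w s tau x0 y0 t0).
Hypothesis Z_max : forall x y t, t <= 0 ->
  two_point w s tau x y t <= two_point w s tau x0 y0 t0.

Let r := enorm (x0 - y0).

(* On the diagonal x = y the function two_point is nonpositive; hence the norm
   is smooth at x0 - y0. *)
Let r_gt0 : 0 < r.
Proof.
rewrite lt_neqAle enorm_ge0 andbT; apply/negP => /eqP r0.
have xy : x0 = y0.
  apply/eqP; rewrite -subr_eq0; apply/eqP/rowP => i; apply/eqP.
  by rewrite [X in _ == X]mxE -normr_le0 r0 coord_le_enorm.
move: Z_gt0; apply/negP; rewrite -leNgt /two_point xy !subrr enorm0.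
have : tau * t0 <= 0 by rewrite mulr_ge0_le0// ltW.
have : 0 <= tau * penalty y0 by rewrite mulr_ge0 ?penalty_ge0// ltW.
by have := s_ge0; lra.
Qed.

Let dir i : R := (x0 - y0) ord0 i / r.

Let dir_le1 i : `|dir i| <= 1.
Proof.
rewrite normrM normfV (ger0_norm (ltW r_gt0)) ler_pdivrMr// mul1r.
exact: coord_le_enorm.
Qed.

Let sum_dir : \sum_(i < n) dir i ^+ 2 = 1.
Proof.
under eq_bigr do rewrite exprMn.
by rewrite -mulr_suml -enorm_sqr exprVn divff// expf_neq0// gt_eqF.
Qed.

Let grad_x i : w1 i x0 t0 = dir i + tau * dpenalty x0 i.
Proof.
rewrite -[x0 in LHS]addr0 -[X in x0 + X](scale0r (delta_mx ord0 i)).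
apply: (@touching_derive1 _ (fun s => w (x0 + s *: delta_mx ord0 i) t0)
  (fun s => w1 i (x0 + s *: delta_mx ord0 i) t0) _ ((2 * r)^-1 + tau / 2)).
  by move=> s'; exact: w_dx.
move=> s' /=; rewrite scale0r addr0.
have := Z_max (x0 + s' *: delta_mx ord0 i) y0 t0_le0.
have := enorm_line_le i s' r_gt0.
have := ler_wpM2l (ltW tau_gt0) (penalty_line_le x0 i s').
rewrite /two_point (addrAC x0 _ (- y0)) /dir -/r; lra.
Qed.

Let grad_y i : w1 i y0 t0 = dir i.
Proof.
apply: oppr_inj.
rewrite -[y0 in LHS]addr0 -[X in y0 + X](scale0r (delta_mx ord0 i)).
apply: (@touching_derive1 _ (fun s => - w (y0 + s *: delta_mx ord0 i) t0)
  (fun s => - w1 i (y0 + s *: delta_mx ord0 i) t0) _ (2 * r)^-1).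
  by move=> s'; have := w_dx i y0 s' t0_le0 => ?; exact: is_deriveN.
move=> s' /=; rewrite scale0r addr0.
have := Z_max x0 (y0 + s' *: delta_mx ord0 i) t0_le0.
have := enorm_line_le i (- s') r_gt0.
rewrite /two_point opprD addrA scaleNr /dir -/r sqrrN; lra.
Qed.

(* Moving x and y in parallel leaves the distance unchanged, so that only the
   penalisation contributes to the second-order condition. *)
Let hessian_le i : w2 i x0 t0 - w2 i y0 t0 <= tau.
Proof.
have -> : tau = 2 * (tau / 2) by field.
apply: (@touching_derive2 _
  (fun s => w (x0 + s *: delta_mx ord0 i) t0 - w (y0 + s *: delta_mx ord0 i) t0)
  (fun s =>
    w1 i (x0 + s *: delta_mx ord0 i) t0 - w1 i (y0 + s *: delta_mx ord0 i) t0)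
  (tau * dpenalty x0 i)).
- move=> s'; have := w_dx i y0 s' t0_le0; have := w_dx i x0 s' t0_le0.
  by move=> ? ?; exact: is_deriveB.
- move=> s' /=; rewrite !scale0r !addr0.
  have := Z_max (x0 + s' *: delta_mx ord0 i) (y0 + s' *: delta_mx ord0 i) t0_le0.
  have := ler_wpM2l (ltW tau_gt0) (penalty_line_le x0 i s').
  by rewrite /two_point opprD addrACA subrr addr0; lra.
- have := w_dxx i y0 t0_le0; have := w_dxx i x0 t0_le0.
  by move=> ? ?; exact: is_deriveB.
Qed.

(* Only earlier times are compared: t0 may be the final time. *)
Let time_ge : - tau <= wt x0 t0 - wt y0 t0.
Proof.
have FF := at_left_proper_filter t0.
have wxy := cvgB (w_dt (x := x0) t0_le0) (w_dt (x := y0) t0_le0).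
apply: (cvgr_to_ge (wxy _)); near=> t.
have tt0 : t < t0 by near: t; exact: nbhs_left_lt.
have := Z_max x0 y0 (ltW (lt_le_trans tt0 t0_le0)).
rewrite /two_point !fctE -mulrBl ler_ndivlMr ?subr_lt0//; lra.
Unshelve. all: by end_near. Qed.

(** At the maximum point both gradients are, up to [tau], the same unit vector,
    the Laplacian at [x0] exceeds that at [y0] by at most [n tau], and the time
    derivative falls behind by at most [tau]. Subtracting the two equations, the
    values of [a - b] are ordered up to [O(tau)]. The constant collects [n] from
    the second derivatives, [1] from the time derivative, and [3 n Q] from
    [|Dw|^2 - 1] at [x0]. *)
Lemma reaction_le_at_max :
  (a x0 t0 - b x0 t0) - (a y0 t0 - b y0 t0) <= (n%:R + 1 + 3 * n%:R * Q) * tau.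
Proof.
have ex := w_eq x0 t0_le0; have ey := w_eq y0 t0_le0.
have hess : \sum_(i < n) w2 i x0 t0 - \sum_(i < n) w2 i y0 t0 <= n%:R * tau.
  rewrite -sumrB; apply: le_trans (ler_sum _ (fun i _ => hessian_le i)) _.
  by rewrite sumr_const card_ord mulr_natl.
have gy : \sum_(i < n) w1 i y0 t0 ^+ 2 = 1.
  by under eq_bigr do rewrite grad_y; exact: sum_dir.
have gx : `|\sum_(i < n) w1 i x0 t0 ^+ 2 - 1| <= n%:R * (3 * tau).
  rewrite -[X in _ - X]sum_dir -sumrB; apply: le_trans (ler_norm_sum _ _ _) _.
  have -> : n%:R * (3 * tau) = \sum_(i < n) (3 * tau).
    by rewrite sumr_const card_ord mulr_natl.
  apply: ler_sum => i _; rewrite grad_x.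
  have := dir_le1 i; have := dpenalty_le1 x0 i.
  move: (dir i) (dpenalty x0 i) => d e e1 d1.
  have -> : (d + tau * e) ^+ 2 - d ^+ 2 = tau * (e * (2 * d + tau * e)) by ring.
  rewrite normrM (ger0_norm (ltW tau_gt0)) mulrC ler_pM2r// normrM.
  rewrite -[leRHS]mul1r ler_pM//.
  apply: le_trans (ler_normD _ _) _; rewrite !normrM (ger0_norm (ltW tau_gt0)).
  rewrite normr_nat.
  have : tau * `|e| <= 1 by rewrite -[leRHS]mulr1 ler_pM// ltW.
  by lra.
have bx := b_bounded x0 t0_le0.
have Q0 : 0 <= Q := le_trans (normr_ge0 _) bx.
have : b x0 t0 * (\sum_(i < n) w1 i x0 t0 ^+ 2 - 1) <= Q * (n%:R * (3 * tau)).
  apply: le_trans (ler_norm _) _; rewrite normrM ler_pM//.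
have := time_ge.
rewrite gy in ey.
move: ex ey hess; lra.
Qed.

Lemma gap_at_max : s <= w x0 t0 - w y0 t0.
Proof.
move: Z_gt0; rewrite /two_point.
have : tau * t0 <= 0 by rewrite mulr_ge0_le0// ltW.
have : 0 <= tau * penalty x0 by rewrite mulr_ge0 ?penalty_ge0// ltW.
have := enorm_ge0 (x0 - y0); have := s_ge0.
by lra.
Qed.

End at_maximum.

(** If the bound failed, [w] would be larger at [x0] than at [y0] by a fixed
    amount at the maximum points for all small [tau]. Strict monotonicity then
    separates the values of [a - b] by a constant [c > 0], against the previous
    lemma once [C tau < c]. *)
Theorem ancient_1lipschitz x y t : t <= 0 -> w x t - w y t <= enorm (x - y).
Proof.
move=> t0; rewrite leNgt; apply/negP => wxy.
pose s := (w x t - w y t - enorm (x - y)) / 2.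
have s0 : 0 < s by rewrite divr_gt0// subr_gt0.
have [c c0 cP] := reaction_increasing s0.
pose C := n%:R + 1 + 3 * n%:R * Q.
have Q0 : 0 <= Q := le_trans (normr_ge0 _) (b_bounded x t0).
have C0 : 0 <= C by rewrite !addr_ge0// !mulr_ge0.
have p0 : 0 <= penalty x - t by rewrite subr_ge0 (le_trans t0)// penalty_ge0.
(* With tau = 1/P the three summands of P ensure tau <= 1, that the
   penalisation at (x, t) is less than s, and that C tau < c. *)
pose P := 1 + (penalty x - t) / s + C / c.
have ps0 : 0 <= (penalty x - t) / s by rewrite divr_ge0// ltW.
have Cc0 : 0 <= C / c by rewrite divr_ge0// ltW.
have P0 : 0 < P by rewrite /P; lra.
have tau0 : 0 < P^-1 by rewrite invr_gt0.
have tau1 : P^-1 <= 1 by rewrite invf_le1// /P; lra.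
have taus : P^-1 * (penalty x - t) < s.
  by rewrite mulrC ltr_pdivrMr// mulrC -ltr_pdivrMr// /P; lra.
have tauc : C * P^-1 < c.
  by rewrite ltr_pdivrMr// mulrC -ltr_pdivrMr// /P; lra.
have Z0 : 0 < two_point w s P^-1 x y t.
  by move: taus; rewrite /two_point; rewrite {1 2}/s; lra.
have [x1 [y1 [t1 [t10 Z1 Zmax]]]] :=
  two_point_max w_cont w_osc (ltW s0) tau0 t0 Z0.
have := reaction_le_at_max (ltW s0) tau0 tau1 t10 Z1 Zmax.
have := cP x1 y1 t1 t10 (gap_at_max (ltW s0) tau0 t10 Z1).
by rewrite -/C; lra.
Qed.

End comparison.

(** * From the Lipschitz bound to the gradient bound *)

Section gradient_of_lipschitz.
Variables (R : realType) (n : nat) (f : 'rV[R]_n -> R).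
Variable (f1 : 'I_n -> 'rV[R]_n -> R).
Hypothesis f_cont : continuous f.
Hypothesis f_dx : forall i x (s : R),
  is_derive s 1 (fun s => f (x + s *: delta_mx ord0 i))
    (f1 i (x + s *: delta_mx ord0 i)).
Hypothesis f_lip : forall x y, f x - f y <= enorm (x - y).

(** Minimise [f + |. - x|^2 / (2 rho)]. At the minimum point [y] the gradient is
    [(x - y) / rho], and moving from [y] towards [x] shows that a 1-Lipschitz
    [f] cannot keep [y] at a distance larger than [rho]. In this way the
    Lipschitz bound, which concerns all directions, is read off from derivatives
    along the coordinate axes. *)
Lemma lipschitz_gradient_le1_near x (rho : R) : 0 < rho ->
  exists2 y, enorm (y - x) <= rho & \sum_(i < n) f1 i y ^+ 2 <= 1.
Proof.
move=> rho0.
pose h y := - f y - enorm (y - x) ^+ 2 / (2 * rho).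
pose K : set 'rV[R]_n :=
  [set y | forall i, y ord0 i \in `[x ord0 i - 2 * rho, x ord0 i + 2 * rho]%R].
have cK : compact K.
  apply: (@rV_compact _ _
    (fun i => `[x ord0 i - 2 * rho, x ord0 i + 2 * rho]%classic)) => i.
  exact: segment_compact.
have ch : continuous h.
  move=> y.
  apply: (@continuousB _ R _ (fun y => - f y)
    (fun y => enorm (y - x) ^+ 2 / (2 * rho))).
    by apply: continuousN; exact: f_cont.
  apply: (@continuous_comp _ _ _ (fun y : 'rV[R]_n => enorm (y - x))
    (fun s => s ^+ 2 / (2 * rho))); last first.
    by apply: cvgM; [exact: exprn_continuous | exact: cvg_cst].
  apply: (@continuous_comp _ _ _ (fun y : 'rV[R]_n => y - x) (@enorm R n));
    last exact: continuous_enorm.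
  apply: (@continuousB _ 'rV[R]_n _ id); first exact: cvg_id.
  exact: cst_continuous.
have Kx : K x by move=> i; rewrite in_itv/=; apply/andP; split; lra.
have K_neq0 : K !=set0 by exists x.
have [y] := compact_EVT_max K_neq0 cK (continuous_subspaceT ch).
rewrite inE => Ky ymax.
have hx : h x = - f x by rewrite /h subrr enorm0 expr0n/= mul0r subr0.
(* Outside K the quadratic term exceeds what the Lipschitz bound lets f gain,
   so that y is a global maximum point of h. *)
have hmax y' : h y' <= h y.
  have [hle|hgt] := leP (h y') (h x).
    by apply: le_trans hle _; apply: ymax; rewrite inE.
  apply: ymax; rewrite inE => i.
  have yx : enorm (y' - x) <= 2 * rho.
    rewrite leNgt; apply/negP => far.
    have := f_lip x y'; have -> : x - y' = (- 1) *: (y' - x).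
      by rewrite scaleN1r opprB.
    rewrite enormZ normrN1 mul1r => fxy.
    have : enorm (y' - x) <= enorm (y' - x) ^+ 2 / (2 * rho).
      rewrite ler_pdivlMr ?mulr_gt0// expr2 ler_wpM2l ?enorm_ge0//.
      exact: ltW.
    by move: hgt; rewrite hx /h; lra.
  have := le_trans (coord_le_enorm (y' - x) i) yx.
  by rewrite !mxE ler_norml in_itv/= => /andP[? ?]; apply/andP; split; lra.
set z := y - x in hmax.
have zrho : enorm z <= rho.
  rewrite leNgt; apply/negP => far.
  have z0 : 0 < enorm z := lt_trans rho0 far.
  (* Moving by k brings the distance down from |z| to rho exactly. *)
  pose k := (enorm z - rho) / enorm z.
  have kz : k * enorm z = enorm z - rho by rewrite divfK// gt_eqF.
  have k0 : 0 < k by rewrite divr_gt0// subr_gt0.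
  have k1 : 0 <= 1 - k.
    by rewrite subr_ge0 ler_pdivrMr// mul1r; lra.
  have := hmax (y - k *: z); have := f_lip (y - k *: z) y.
  have -> : y - k *: z - y = (- k) *: z by rewrite addrAC subrr add0r scaleNr.
  rewrite enormZ normrN (gtr0_norm k0) /h.
  have -> : y - k *: z - x = (1 - k) *: z.
    by rewrite scalerBl scale1r /z addrAC.
  rewrite enormZ (ger0_norm k1) -/z => fy.
  rewrite exprMn -mulrA; set e2 := enorm z ^+ 2 / (2 * rho) => hy.
  have e2E : e2 * (2 * rho) = enorm z ^+ 2.
    by rewrite divfK// mulf_neq0// gt_eqF.
  have : k * (e2 * (2 - k)) <= k * enorm z by lra.
  rewrite ler_pM2l// -(ler_pM2r (mulr_gt0 (ltr0Sn R 1) rho0)).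
  have -> : e2 * (2 - k) * (2 * rho) = enorm z * (enorm z + rho).
    by rewrite mulrAC e2E mulrBr expr2 -(mulrA _ _ k) (mulrC _ k) kz; ring.
  by rewrite ler_pM2l//; lra.
exists y => //.
have grad i : f1 i y = - (z ord0 i / rho).
  apply: oppr_inj; rewrite opprK.
  rewrite -[y in LHS]addr0 -[X in y + X](scale0r (delta_mx ord0 i)).
  apply: (@touching_derive1 _ (fun s => - f (y + s *: delta_mx ord0 i))
    (fun s => - f1 i (y + s *: delta_mx ord0 i)) _ (2 * rho)^-1).
  move=> s /=; rewrite scale0r addr0.
  have := hmax (y + s *: delta_mx ord0 i); rewrite /h addrAC -/z.
  rewrite [enorm (z + _) ^+ 2]enorm_sqr (sum_line_coord (fun a => a ^+ 2)).
  rewrite -enorm_sqr.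
  have -> : (enorm z ^+ 2 + ((z ord0 i + s) ^+ 2 - z ord0 i ^+ 2)) / (2 * rho)
      = enorm z ^+ 2 / (2 * rho) + z ord0 i / rho * s + (2 * rho)^-1 * s ^+ 2.
    by field; rewrite gt_eqF.
  by lra.
under eq_bigr do rewrite grad sqrrN exprMn.
have zr0 : 0 <= enorm z / rho by rewrite divr_ge0 ?enorm_ge0// ltW.
by rewrite -mulr_suml -enorm_sqr -exprMn expr_le1// ler_pdivrMr// mul1r.
Qed.

Lemma lipschitz_gradient_le1 x : (forall i, {for x, continuous (f1 i)}) ->
  \sum_(i < n) f1 i x ^+ 2 <= 1.
Proof.
move=> cf1; rewrite leNgt; apply/negP => gt1.
have csum : \sum_(i < n) f1 i y ^+ 2 @[y --> x] --> \sum_(i < n) f1 i x ^+ 2.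
  apply: (@cvg_big _ _ _ _ _ add_continuous _ (nbhs x)) => i _.
  apply: (@continuous_comp _ _ _ (f1 i) (fun s => s ^+ 2)); first exact: cf1.
  exact: exprn_continuous.
have : \forall y \near x, 1 < \sum_(i < n) f1 i y ^+ 2.
  exact: (cvgr_gt _ csum).
move=> /nbhs_ballP[e /= e0 ball_gt1].
have e20 : 0 < e / 2 by rewrite divr_gt0.
have [y yx] := lipschitz_gradient_le1_near x e20.
apply/negP; rewrite -ltNge; apply: ball_gt1; split => // i j.
rewrite ord1 /ball /= distrC.
have := le_trans (coord_le_enorm (y - x) j) yx; rewrite !mxE.
by move=> yxe; apply: le_lt_trans yxe _; lra.
Qed.

End gradient_of_lipschitz.

(** * The change of unknown *)

Lemma mean_value (R : realType) (f df : R -> R) (a b : R) : a <= b ->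
  (forall s, s \in `[a, b]%R -> is_derive s 1 f (df s)) ->
  exists2 c, c \in `[a, b]%R & f b - f a = df c * (b - a).
Proof.
move=> ab f_df.
have cf : {within `[a, b], continuous f}.
  by apply: derivable_within_continuous => s /f_df; case.
have f_df' s : s \in `]a, b[%R -> is_derive s 1 f (df s).
  by move=> sab; apply: f_df; exact: subset_itv_oo_cc sab.
exact: (MVT_segment ab f_df' cf).
Qed.

(** The potential is perturbed to [energy], and the new unknown is [psi (u)]
    with [psi' = weight = 1 / sqrt (2 energy)]. Where the gradient of [psi (u)] has
    length one, the right-hand side of its equation is [excess]; without the
    perturbation it would vanish identically. The perturbation is chosen to make
    [excess] strictly increasing. *)
Section profile.
Variables (R : realType) (F dF : R -> R) (eps B M : R).
Hypotheses (eps_gt0 : 0 < eps) (F_ge0 : forall s, 0 <= F s).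
Hypothesis F_dF : forall s : R, is_derive s 1 F (dF s).
Hypothesis dF_le : forall s, s \in `[- B, B]%R -> `|dF s| <= M.

(** Large enough for the growth of the exponential in [excess] to outweigh the
    decrease of [weight], whose logarithmic derivative is at least
    [- M / (2 eps)] where the bound on [dF] holds. *)
Definition rate : R := 1 + M / (2 * eps).

(** The shift by [B + 1] keeps this function at most one, hence [energy] at
    least [eps], on a neighbourhood of the interval [-B, B] that contains the
    values of the solution. *)
Definition profile_exp (s : R) : R := expR (rate * (s - (B + 1))).

Definition energy (s : R) : R := F s + eps * (2 - profile_exp s).

Definition denergy (s : R) : R := dF s - eps * rate * profile_exp s.

Definition weight (s : R) : R := (Num.sqrt (2 * energy s))^-1.

Definition excess (s : R) : R := weight s * (dF s - denergy s).

Hypothesis M_ge0 : 0 <= M.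

Lemma rate_ge1 : 1 <= rate.
Proof. by rewrite /rate lerDl divr_ge0// mulr_ge0// ltW. Qed.

Lemma profile_exp_le1 s : s <= B + 1 -> profile_exp s <= 1.
Proof.
move=> sB; rewrite -expR0 ler_expR mulr_ge0_le0 ?subr_le0//.
exact: le_trans rate_ge1.
Qed.

Lemma energy_ge s : s <= B + 1 -> eps <= energy s.
Proof.
move=> /profile_exp_le1 e1; have := F_ge0 s; rewrite /energy.
have : eps * 1 <= eps * (2 - profile_exp s) by rewrite ler_pM2l//; lra.
by lra.
Qed.

Lemma energy_le s : energy s <= F s + 2 * eps.
Proof.
rewrite /energy lerD2l (mulrC 2) ler_pM2l// gerBl; exact: expR_ge0.
Qed.

Lemma energy_gt0 s : s <= B + 1 -> 0 < energy s.
Proof. by move=> /energy_ge; exact: lt_le_trans. Qed.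

Lemma weight_gt0 s : s <= B + 1 -> 0 < weight s.
Proof. by move=> sB; rewrite invr_gt0 sqrtr_gt0 mulr_gt0// energy_gt0. Qed.

Lemma weight_sqr s : s <= B + 1 -> weight s ^+ 2 * (2 * energy s) = 1.
Proof.
move=> sB; have e0 : 0 < 2 * energy s by rewrite mulr_gt0// energy_gt0.
by rewrite exprVn sqr_sqrtr ?ltW// mulVf// gt_eqF.
Qed.

Lemma weight_le s : s <= B + 1 -> weight s <= (Num.sqrt (2 * eps))^-1.
Proof.
move=> sB; rewrite lef_pV2 ?posrE ?sqrtr_gt0 ?mulr_gt0 ?energy_gt0//.
by rewrite ler_wsqrtr// ler_pM2l// energy_ge.
Qed.

Lemma is_derive_profile_exp (s : R) :
  is_derive s 1 profile_exp (rate * profile_exp s).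
Proof.
have lin : is_derive s 1 (fun s => rate * (s - (B + 1))) rate.
  by apply: is_derive_eq; rewrite /GRing.scale/=; ring.
rewrite mulrC; exact: is_derive1_comp.
Qed.

Lemma is_derive_energy (s : R) : is_derive s 1 energy (denergy s).
Proof.
have := is_derive_profile_exp s; have := F_dF s => ? ?.
apply: is_derive_eq; rewrite /denergy /GRing.scale/=; ring.
Qed.

Lemma is_derive_weight (s : R) : s <= B + 1 ->
  is_derive s 1 weight (- denergy s * weight s ^+ 3).
Proof.
move=> sB; have e0 : 0 < 2 * energy s by rewrite mulr_gt0// energy_gt0.
have lin : is_derive s 1 (fun s => 2 * energy s) (2 * denergy s).
  by have := is_derive_energy s => ?; apply: is_derive_eq.
have sq0 : Num.sqrt (2 * energy s) != 0 by rewrite gt_eqF// sqrtr_gt0.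
have sq : is_derive s 1 (fun s => Num.sqrt (2 * energy s))
    ((2 * Num.sqrt (2 * energy s))^-1 * (2 * denergy s)).
  exact: (@is_derive1_comp _ Num.sqrt (fun s => 2 * energy s) _ _ _
    (is_derive1_sqrt e0) lin).
have := @is_deriveV _ (fun s => Num.sqrt (2 * energy s)) s _ 1 sq0 sq => dw.
apply: is_derive_eq.
rewrite /weight /GRing.scale/=; field; exact/sq0.
Qed.

Lemma continuous_weight s : s <= B + 1 -> {for s, continuous weight}.
Proof.
move=> sB; apply: differentiable_continuous; apply/derivable1_diffP.
by case: (is_derive_weight sB).
Qed.

Lemma excessE s : excess s = eps * rate * weight s * profile_exp s.
Proof. by rewrite /excess /denergy; ring. Qed.

Lemma excess_gt0 s : s <= B + 1 -> 0 < excess s.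
Proof.
move=> sB; rewrite excessE !mulr_gt0 ?weight_gt0 ?expR_gt0//.
exact: lt_le_trans rate_ge1.
Qed.

Lemma is_derive_excess (s : R) : s <= B + 1 ->
  is_derive s 1 excess (excess s * (rate - denergy s * weight s ^+ 2)).
Proof.
move=> sB; have := is_derive_profile_exp s; have := is_derive_weight sB => ? ?.
have -> : excess = (fun s => eps * rate * weight s * profile_exp s).
  by apply/funext => x; rewrite excessE.
by apply: is_derive_eq; rewrite /GRing.scale/=; ring.
Qed.

(** The logarithmic derivative of [excess] is
    [rate - denergy / (2 energy) >= 1], because
    [denergy <= dF <= M] and [energy >= eps]. *)
Lemma excess_derive_ge s : s \in `[- B, B]%R ->
  excess s <= excess s * (rate - denergy s * weight s ^+ 2).
Proof.
move=> sB; have sB1 : s <= B + 1.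
  by move: sB; rewrite in_itv/= => /andP[_ sB]; lra.
rewrite ler_pMr ?excess_gt0// /rate lerBrDr lerD2l.
have e0 := energy_gt0 sB1.
have w2 : weight s ^+ 2 = (2 * energy s)^-1.
  by rewrite /weight exprVn sqr_sqrtr// ltW// mulr_gt0.
rewrite w2.
have dM : denergy s <= M.
  apply: le_trans _ (dF_le sB); apply: le_trans _ (ler_norm _).
  rewrite /denergy gerBl !mulr_ge0 ?expR_ge0 ?(ltW eps_gt0)//.
  exact: le_trans rate_ge1.
apply: (@le_trans _ _ (M * (2 * energy s)^-1)).
  by rewrite ler_pM2r// invr_gt0 mulr_gt0.
by rewrite ler_wpM2l// lef_pV2 ?posrE ?mulr_gt0// ler_pM2l// energy_ge.
Qed.

(** By the mean value theorem and the previous lemma the slope is at least a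
    value of [excess], and [excess] itself is smallest at [- B]. *)
Lemma excess_increasing s1 s2 : - B <= s1 -> s1 <= s2 -> s2 <= B ->
  excess (- B) * (s2 - s1) <= excess s2 - excess s1.
Proof.
have mono t1 t2 : - B <= t1 -> t1 <= t2 -> t2 <= B ->
    exists2 c, c \in `[t1, t2]%R & excess c * (t2 - t1) <= excess t2 - excess t1.
  move=> Bt1 t12 t2B.
  have [|c ct ->] := mean_value (f := excess)
      (df := fun s => excess s * (rate - denergy s * weight s ^+ 2)) t12.
    move=> s; rewrite in_itv/= => /andP[_ st2]; apply: is_derive_excess; lra.
  exists c => //; rewrite ler_wpM2r ?subr_ge0// excess_derive_ge//.
  move: ct; rewrite !in_itv/= => /andP[? ?]; apply/andP; split; lra.
move=> Bs1 s12 s2B; have [c] := mono _ _ Bs1 s12 s2B.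
rewrite in_itv/= => /andP[s1c cs2]; apply: le_trans.
rewrite ler_wpM2r ?subr_ge0//.
have Bc : - B <= c by exact: le_trans s1c.
have cB : c <= B by exact: le_trans cs2 _.
have [d] := mono _ _ (lexx (- B)) Bc cB.
rewrite in_itv/= => /andP[Bd dc] dP; rewrite -subr_ge0; apply: le_trans dP.
rewrite mulr_ge0 ?subr_ge0// ltW// excess_gt0//; lra.
Qed.

End profile.

(** * The perturbed estimate *)

Section perturbed_estimate.
Variables (R : realType) (n : nat) (F dF : R -> R) (eps B M : R).
Variable u : 'rV[R]_n -> R -> R.
Hypotheses (eps_gt0 : 0 < eps) (M_ge0 : 0 <= M) (F_ge0 : forall s, 0 <= F s).
Hypothesis F_dF : forall s : R, is_derive s 1 F (dF s).
Hypothesis dF_le : forall s, s \in `[- B, B]%R -> `|dF s| <= M.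
Hypothesis u_C21 : C21 u.
Hypothesis u_eq : forall x t, t <= 0 ->
  laplacex u x t = dt u x t + dF (u x t).
Hypothesis u_bnd : forall x t, t <= 0 -> u x t \in `[- B, B]%R.

Let G := energy F eps B M.
Let dG := denergy dF eps B M.
Let q := weight F eps B M.
Let k := excess F dF eps B M.

Let u_le x t : t <= 0 -> u x t <= B + 1.
Proof. by move=> /(u_bnd x); rewrite in_itv/= => /andP[_ ?]; lra. Qed.

Let u_cont : {within past R n, continuous (fun p => u p.1 p.2)}.
Proof. by case: u_C21. Qed.

Let u_dx i x t (s : R) : t <= 0 ->
  is_derive s 1 (fun s => u (x + s *: delta_mx ord0 i) t)
    (dx u i (x + s *: delta_mx ord0 i) t).
Proof.
move=> t0; case: u_C21 => + _ _ _ _.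
move=> /(_ (x + s *: delta_mx ord0 i) t t0)[du _ _].
exact: (is_derive_line (f := u ^~ t) (du i)).
Qed.

Let u_dxx i x t : t <= 0 ->
  is_derive (0 : R) 1 (fun s => dx u i (x + s *: delta_mx ord0 i) t)
    (dx (dx u i) i x t).
Proof.
move=> t0; case: u_C21 => + _ _ _ _.
move=> /(_ (x + 0 *: delta_mx ord0 i) t t0)[_ du _].
have := is_derive_line (f := (dx u i) ^~ t) (du i i).
by rewrite [in X in 'D_ _ _ X]scale0r [in X in 'D_ _ _ X]addr0.
Qed.

Let u_dt x t : t <= 0 -> (u x s - u x t) / (s - t) @[s --> t^'-] --> dt u x t.
Proof.
move=> t0; case: u_C21 => /(_ x t t0)[_ _ ut] _ _ _ _.
apply: cvg_trans ut; apply: cvg_app => U; rewrite /at_left /dnbhs /within /=.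
apply: (@filterS _ (nbhs t)) => s sU st; apply: sU; first by rewrite lt_eqF.
exact: ltW (lt_le_trans st t0).
Qed.

Let u_cvg_left x t : t <= 0 -> u x s @[s --> t^'-] --> u x t.
Proof.
move=> t0.
have cu : u x (Num.min s 0) @[s --> t] --> u x (Num.min t 0).
  apply: (@continuous_comp _ _ _ (fun s : R => (x, s))
    (fun p : 'rV[R]_n * R => u p.1 (Num.min p.2 0))).
    apply: (@cvg_pair _ _ _ _ (nbhs x) (nbhs t)); first exact: cvg_cst.
    exact: cvg_id.
  exact: past_continuous_min.
rewrite min_l// in cu.
apply: cvg_trans (cvg_at_left_filter cu); apply: near_eq_cvg; near=> s.
rewrite min_l// (le_trans _ t0)// ltW//; near: s; exact: nbhs_left_lt.
Unshelve. all: by end_near. Qed.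

(** With [w = psi (u)] one has [Dw = weight(u) Du], so that
    [ancient_1lipschitz] bounds [weight(u)^2 |Du|^2] by one. *)
Lemma perturbed_gradient_bound x t : t <= 0 ->
  \sum_(i < n) dx u i x t ^+ 2 <= 2 * energy F eps B M (u x t).
Proof.
have q_cont : {in `[- (B + 1), B + 1]%R, continuous q}.
  by move=> s; rewrite in_itv/= => /andP[_ ?]; exact: continuous_weight.
have [psi psi_q] := ex_antiderivative q_cont.
have u_in x' t' : t' <= 0 -> u x' t' \in `]- (B + 1), B + 1[%R.
  by move=> /(u_bnd x'); rewrite !in_itv/= => /andP[? ?]; apply/andP; split; lra.
pose w x t := psi (u x t).
pose w1 i x t := q (u x t) * dx u i x t.
pose w2 i x t := q (u x t) * dx (dx u i) i x t
  - dG (u x t) * q (u x t) ^+ 3 * dx u i x t ^+ 2.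
pose wt x t := q (u x t) * dt u x t.
pose c0 := (Num.sqrt (2 * eps))^-1.
have c0_gt0 : 0 < c0 by rewrite invr_gt0 sqrtr_gt0 mulr_gt0.
have psi_incr s1 s2 : s1 \in `[- B, B]%R -> s2 \in `[- B, B]%R -> s1 <= s2 ->
    0 <= psi s2 - psi s1 <= c0 * (s2 - s1).
  rewrite !in_itv/= => /andP[Bs1 s1B] /andP[Bs2 s2B] s12.
  have psi_q12 s : s \in `[s1, s2]%R -> is_derive s 1 psi (q s).
    rewrite in_itv/= => /andP[s1s ss2]; apply: psi_q.
    by rewrite in_itv/=; apply/andP; split; lra.
  have [s s_in ->] := mean_value s12 psi_q12.
  move: s_in; rewrite in_itv/= => /andP[s1s ss2].
  have sB : s <= B + 1 by lra.
  apply/andP; split; last by rewrite ler_wpM2r ?subr_ge0// weight_le.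
  by rewrite mulr_ge0 ?subr_ge0// ltW// weight_gt0.
have w_cont : {within past R n, continuous (fun p => w p.1 p.2)}.
  apply/subspace_continuousP => -[x' t'] /= t'0.
  have cpsi : {for u x' t', continuous psi}.
    apply: differentiable_continuous; apply/derivable1_diffP.
    by case: (psi_q _ (u_in x' t' t'0)).
  have /subspace_continuousP/(_ (x', t') t'0) cu := u_cont.
  exact: (cvg_comp _ psi cu cpsi).
have w_dx i x' t' (s : R) : t' <= 0 ->
    is_derive s 1 (fun s => w (x' + s *: delta_mx ord0 i) t')
      (w1 i (x' + s *: delta_mx ord0 i) t').
  move=> t'0.
  exact: (@is_derive1_comp _ psi (fun s => u (x' + s *: delta_mx ord0 i) t')
    s _ _ (psi_q _ (u_in _ _ t'0)) (u_dx i x' s t'0)).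
have w_dxx i x' t' : t' <= 0 ->
    is_derive (0 : R) 1 (fun s => w1 i (x' + s *: delta_mx ord0 i) t')
      (w2 i x' t').
  move=> t'0; have := u_dx i x' 0 t'0; rewrite scale0r addr0 => du.
  have dq : is_derive (u (x' + 0 *: delta_mx ord0 i) t') 1 q
      (- dG (u x' t') * q (u x' t') ^+ 3).
    by rewrite scale0r addr0; apply: is_derive_weight => //; exact: u_le.
  have dqu := @is_derive1_comp _ q (fun s => u (x' + s *: delta_mx ord0 i) t')
    0 _ _ dq du.
  have dw1 := is_deriveM dqu (u_dxx i x' t'0).
  apply: is_derive_eq.
  rewrite /= scale0r addr0 /w2 /GRing.scale/=; ring.
have w_dt x' t' : t' <= 0 ->
    (w x' s - w x' t') / (s - t') @[s --> t'^'-] --> wt x' t'.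
  move=> t'0.
  have /is_derive1_caratheodory[g [gE cg gq]] := psi_q _ (u_in x' t' t'0).
  have -> : (fun s => (w x' s - w x' t') / (s - t'))
      = (fun s => g (u x' s) * ((u x' s - u x' t') / (s - t'))).
    by apply/funext => s; rewrite /w gE mulrA.
  apply: cvgM; last exact: u_dt.
  rewrite -/q -gq; exact: (cvg_comp _ g (u_cvg_left t'0) cg).
pose a x t := q (u x t) * dF (u x t).
pose b x t := q (u x t) * dG (u x t).
have w_eq x' t' : t' <= 0 -> \sum_(i < n) w2 i x' t' - wt x' t'
    = a x' t' - b x' t' * \sum_(i < n) w1 i x' t' ^+ 2.
  move=> t'0; rewrite /w2 sumrB -mulr_sumr -mulr_sumr.
  have -> : \sum_(i < n) dx (dx u i) i x' t' = dt u x' t' + dF (u x' t').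
    exact: u_eq.
  under [in RHS]eq_bigr do rewrite exprMn.
  rewrite -mulr_sumr /wt /a /b; ring.
have b_bnd x' t' : t' <= 0 -> `|b x' t'| <= c0 * (M + eps * rate eps M).
  move=> t'0; have ule := u_le x' t'0.
  rewrite normrM (gtr0_norm (weight_gt0 _ _ _ ule))// ler_pM//.
  - by rewrite ltW// weight_gt0.
  - exact: weight_le.
  - apply: le_trans (ler_normB _ _) _; apply: lerD; first exact/dF_le/u_bnd.
    rewrite ger0_norm; last first.
      by rewrite !mulr_ge0 ?expR_ge0 ?(ltW eps_gt0) ?(le_trans _ (rate_ge1 _ _)).
    rewrite ler_piMr ?profile_exp_le1// mulr_ge0 ?(ltW eps_gt0)//.
    by rewrite (le_trans _ (rate_ge1 _ _)).
have w_osc x' y' t' : t' <= 0 -> w x' t' - w y' t' <= c0 * (2 * B).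
  move=> t'0; have ux := u_bnd x' t'0; have uy := u_bnd y' t'0.
  have B0 : 0 <= B by move: ux; rewrite in_itv/= => /andP[? ?]; lra.
  have [uxy|uxy] := leP (u y' t') (u x' t').
    have /andP[_] := psi_incr _ _ uy ux uxy; move/le_trans; apply.
    rewrite ler_pM2l//.
    by move: ux uy; rewrite !in_itv/= => /andP[? ?] /andP[? ?]; lra.
  have /andP[+ _] := psi_incr _ _ ux uy (ltW uxy).
  have : 0 <= c0 * (2 * B) by rewrite !mulr_ge0// ltW.
  rewrite /w; lra.
have gap s : 0 < s -> exists2 c : R, 0 < c &
    forall x y t, t <= 0 -> s <= w x t - w y t ->
      c <= (a x t - b x t) - (a y t - b y t).
  (* When B < 0 the interval of admissible values is empty. *)
  move=> s0; have [B0|B0] := ltP B 0.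
    exists 1 => // x' y' t' t'0 _; have := u_bnd x' t'0.
    by rewrite in_itv/= => /andP[? ?]; lra.
  have k0 : 0 < k (- B) by apply: excess_gt0 => //; lra.
  exists (k (- B) * (s / c0)); first by rewrite mulr_gt0// divr_gt0.
  move=> x' y' t' t'0 sw; have ux := u_bnd x' t'0; have uy := u_bnd y' t'0.
  have uyx : u y' t' <= u x' t'.
    rewrite leNgt; apply/negP => uxy.
    have /andP[+ _] := psi_incr _ _ ux uy (ltW uxy).
    by move: sw; rewrite /w; lra.
  have /andP[_ psi_le] := psi_incr _ _ uy ux uyx.
  have su : s / c0 <= u x' t' - u y' t'.
    by rewrite ler_pdivrMr// mulrC (le_trans sw).
  rewrite /a /b -!mulrBr.
  move: ux uy; rewrite !in_itv/= => /andP[_ uxB] /andP[Buy _].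
  apply: le_trans _ (excess_increasing _ _ _ _ _ Buy uyx uxB) => //.
  by rewrite ler_pM2l.
move=> t0.
have lip y z : w y t - w z t <= enorm (y - z).
  exact: (ancient_1lipschitz w_cont w_osc w_dx w_dxx w_dt w_eq b_bnd gap).
have cw : continuous (w ^~ t) by exact: past_continuous_slice.
have cw1 i : {for x, continuous (fun y => w1 i y t)}.
  have cqu : continuous (fun y => q (u y t)).
    move=> y; apply: (@continuous_comp _ _ _ (u ^~ t) q).
      exact: past_continuous_slice.
    by apply: continuous_weight => //; exact: u_le.
  have cdx : continuous ((dx u i) ^~ t).
    by apply: past_continuous_slice => //; case: u_C21.
  exact: (continuousM (cqu x) (cdx x)).
have := lipschitz_gradient_le1 cw (fun i y s => w_dx i y t s t0) lip cw1.
have ule := u_le x t0.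
under eq_bigr do rewrite exprMn.
rewrite -mulr_sumr -[X in _ <= X -> _](weight_sqr eps_gt0 F_ge0 M_ge0 ule).
rewrite ler_pM2l//.
by rewrite exprn_gt0// weight_gt0.
Qed.

End perturbed_estimate.

Theorem theorem4p1 (R : realType) (n : nat) (beta : R) (F : R -> R)
    (u : 'rV[R]_n -> R -> R) :
  0 < beta ->
  C2_holder_loc beta F ->
  (forall s, 0 <= F s) ->
  classical_solution F u ->
  [bounded u p.1 p.2 | p in past R n] ->
  forall (x : 'rV[R]_n) (t : R), t <= 0 ->
    enorm (gradx u x t) ^+ 2 - 2 * F (u x t) <= 0.
Proof.
move=> _ [dF ddF _ _] F0 [uC ueq] ubnd x t t0.
have F_dF (s : R) : is_derive s 1 F (derive1 F s).
  by rewrite derive1E; exact: derivableP.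
have [B B0 u_le] := pinfty_ex_gt0 ubnd.
have u_in y s : s <= 0 -> u y s \in `[- B, B]%R.
  by move=> s0; rewrite in_itv/= -ler_norml; exact: (u_le (y, s)).
have cdF : {within `[- B, B], continuous (fun s => `|derive1 F s|)}.
  apply: continuous_subspaceT => s; apply: continuous_comp.
    by apply: differentiable_continuous; exact/derivable1_diffP.
  exact: norm_continuous.
have BB : - B <= B by lra.
have [c _ dF_le] := EVT_max BB cdF.
rewrite subr_le0 enorm_sqr; apply/ler_addgt0Pr => e e0.
have e40 : 0 < e / 4 by rewrite divr_gt0.
under eq_bigr do rewrite mxE.
apply: le_trans (perturbed_gradient_bound e40 (normr_ge0 _) F0 F_dF dF_le uC ueq
  u_in x t0) _.
by have := energy_le F B `|derive1 F c| e40 (u x t); lra.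
Qed.
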